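(* Let $q\in\{2,3\}$ and let $A=(a_{ij})\in\mathbb{F}_q^{m\times k}$ be a row-balanced matrix (i.e. $\sum_{j=1}^k a_{ij}=0$ for all $i\in[m]$) of rank $m$. Then the system $Ax^\mathsf{T}=0$ is temperate.
   Context: For $x=(x_1,\ldots,x_k)$ with $x_j\in\mathbb{F}_q^n$, the system $Ax^\mathsf{T}=0$ means $a_{i1}x_1+\cdots+a_{ik}x_k=0$ for all $i\in[m]$. A solution $x$ is contained in $S\subseteq\mathbb{F}_q^n$ if $x_1,\ldots,x_k\in S$. A solution $x$ is \emph{generic} if every $(\mu_1,\ldots,\mu_k)\in\mathbb{F}_q^k$ with $\sum_j\mu_j=0$ and $\sum_j\mu_jx_j=0$ lies in the row space of $A$. The system is \emph{temperate} if there is $\delta>0$ such that $|S|=O(q^{(1-\delta)n})$ as $n\to\infty$ for every $S\subseteq\mathbb{F}_q^n$ containing no generic solution. *)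

(* Defs.v *)
From mathcomp Require Import all_boot all_order all_algebra.
From mathcomp Require Import all_classical all_reals all_analysis.

Set Implicit Arguments.
Unset Strict Implicit.
Unset Printing Implicit Defensive.

Import Order.TTheory GRing.Theory Num.Theory.

Local Open Scope ring_scope.

Definition row_balanced (F : finFieldType) (m k : nat) (A : 'M[F]_(m, k)) :
    Prop :=
  forall i : 'I_m, \sum_(j < k) A i j = 0.

Definition solution (F : finFieldType) (m k n : nat) (A : 'M[F]_(m, k))
    (x : 'I_k -> 'rV[F]_n) : Prop :=
  forall i : 'I_m, \sum_(j < k) A i j *: x j = 0.

Definition contained (F : finFieldType) (k n : nat)
    (x : 'I_k -> 'rV[F]_n) (S : {set 'rV[F]_n}) : Prop :=
  forall j : 'I_k, x j \in S.

(* The only affine dependences among the x_j are those forced by the system: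
   [(mu <= A)%MS] says that mu lies in the row space of A. *)
Definition generic_solution (F : finFieldType) (m k n : nat)
    (A : 'M[F]_(m, k)) (x : 'I_k -> 'rV[F]_n) : Prop :=
  solution A x /\
  forall mu : 'rV[F]_k,
    \sum_(j < k) mu 0 j = 0 -> \sum_(j < k) mu 0 j *: x j = 0 ->
    (mu <= A)%MS.

(* The constant C of the O(.) bound depends on A and delta only: it is uniform
   over all S.  The field F has q = #|F| elements. *)
Definition temperate (R : realType) (F : finFieldType) (m k : nat)
    (A : 'M[F]_(m, k)) : Prop :=
  exists2 delta : R, 0 < delta &
  exists C : R, \forall n \near \oo%classic,
    forall S : {set 'rV[F]_n},
      ~ (exists x : 'I_k -> 'rV[F]_n,
           generic_solution A x /\ contained x S) ->
      #|S|%:R <= C * (#|F|%:R `^ ((1 - delta) * n%:R)).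

(* Main.v *)
(* A generic solution is the image of the rows of [cokermx A] under any
   injective affine map F^k -> F^n, so it suffices to find k-dimensional affine
   flats in every set of density at least q^(-t) when n >= b t.  For k = 1 this
   is trivial if q = 2 and the Ellenberg-Gijswijt cap set theorem if q = 3; the
   dimension is then raised by one at a time by a product argument on the fibres
   of F^(r+s) -> F^s. *)

Require Import Defs.
From mathcomp Require Import all_boot all_order all_algebra.
From mathcomp Require Import all_classical all_reals all_analysis.
From mathcomp Require Import finset fingroup cyclic finfield ring lra zify.

Set Implicit Arguments.
Unset Strict Implicit.
Unset Printing Implicit Defensive.

Import Order.TTheory GRing.Theory Num.Theory.

Local Open Scope ring_scope.

(** * Ranks of sums and vectors in a left kernel *)

Lemma mxrank_sum_le (F : fieldType) (I : finType) (P : pred I) (m n : nat)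
    (B : I -> 'M[F]_(m, n)) :
  (\rank (\sum_(i | P i) B i)%R <= \sum_(i | P i) \rank (B i))%N.
Proof.
apply: (big_ind2 (fun M r => \rank M <= r)%N) => // [|M1 r1 M2 r2 le1 le2].
  by rewrite mxrank0.
by rewrite (leq_trans (mxrank_add _ _)) ?leq_add.
Qed.

(** Terms with the same label [p i] combine into one column times one row, of rank at most 1. *)
Lemma mxrank_sum_outer_le (F : fieldType) (I J : finType) (L : {set J})
    (P : pred I) (p : I -> J) (m n : nat) (u : J -> 'cV[F]_m)
    (g : I -> 'rV[F]_n) :
  (forall i, P i -> p i \in L) ->
  (\rank (\sum_(i | P i) u (p i) *m g i)%R <= #|L|)%N.
Proof.
move=> PL; rewrite (partition_big p (mem L)) //=.
rewrite (leq_trans (mxrank_sum_le _ _))// -sum1_card leq_sum// => j jL.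
rewrite (eq_bigr (fun i => u j *m g i)); last by move=> i /andP[_ /eqP->].
by rewrite -mulmx_sumr (leq_trans (mxrankM_maxl _ _)) ?rank_leq_col.
Qed.

(** The left kernel of [E] has dimension [r >= a - l]. Its matrix [K] has [r] independent columns,
    so the kernel projects onto those coordinates and some kernel vector is 1 on all of them. *)
Lemma annihilator_ones (F : fieldType) (a l : nat) (E : 'M[F]_(a, l)) :
  exists r (g : 'I_r -> 'I_a) (h : 'rV[F]_a),
    [/\ (a <= r + l)%N, injective g, h *m E = 0 & forall i, h 0 (g i) = 1].
Proof.
pose K := kermx E; pose g := maxrankfun K^T.
pose w := pinvmx (rowsub g K^T) *m const_mx 1 : 'cV_a.
exists (\rank K^T), g, (w^T *m K); split.
- rewrite mxrank_tr mxrank_ker; have := rank_leq_col E; lia.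
- exact: maxrankfun_inj.
- by rewrite -mulmxA mulmx_ker mulmx0.
- move=> i; have wE : rowsub g (K^T *m w) = const_mx 1.
    by rewrite -mul_rowsub_mx mulmxA mulmxVp ?maxrowsub_free// mul1mx.
  have <- : (K^T *m w)^T = w^T *m K by rewrite trmx_mul trmxK.
  by have /matrixP/(_ i 0) := wE; rewrite !mxE.
Qed.

(** * Size of cap sets over the field of three elements *)

Section CapSet.

Variable F : finFieldType.
Hypothesis F3 : #|F| = 3%N.

Lemma three_eq0 : 3%:R = 0 :> F.
Proof.
have := @expg_cardG F [set: F]%G 1%R (in_setT _).
by rewrite finset.cardsT F3.
Qed.

Lemma F3_cases (x : F) : [\/ x = 0, x = 1 | x = -1].
Proof.
have := expf_card x; rewrite F3 => x3.
have : x * ((x - 1) * (x + 1)) == 0.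
  by apply/eqP; rewrite -(subrr x) -[X in _ = X - _]x3; ring.
rewrite !mulf_eq0 subr_eq0 addr_eq0 => /or3P[] /eqP ->; by constructor.
Qed.

Local Notation exponent n := {ffun 'I_n -> 'I_3}.

Definition monomial n (e : exponent n) (x : 'rV[F]_n) : F :=
  \prod_(i < n) x 0 i ^+ e i.

Definition low_exponents n : {set exponent n} :=
  [set e : exponent n | \sum_(i < n) e i <= (2 * n) %/ 3]%N.

(* Coefficient of [x ^ a * y ^ b * z ^ c] in [1 - (x + y + z) ^ 2]. *)
Definition line_coef (t : 'I_3 * 'I_3 * 'I_3) : F :=
  let: (a, b, c) := t in
  if (a + b + c == 0)%N then 1
  else if (a + b + c == 2)%N then
    if [|| a == 2 :> nat, b == 2 :> nat | c == 2 :> nat] then -1 else -2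
  else 0.

Lemma line_coefE (x y z : F) :
  1 - (x + y + z) ^+ 2 =
  \sum_(t : 'I_3 * 'I_3 * 'I_3)
     line_coef t * (x ^+ t.1.1 * y ^+ t.1.2 * z ^+ t.2).
Proof.
transitivity (\sum_(a < 3) \sum_(b < 3) \sum_(c < 3)
    line_coef (a, b, c) * (x ^+ a * y ^+ b * z ^+ c)).
  by rewrite !big_ord_recl !big_ord0 /line_coef /=; ring.
by rewrite pair_bigA pair_bigA; apply: eq_bigr => -[[a b] c].
Qed.

Lemma line_coef_degree (t : 'I_3 * 'I_3 * 'I_3) :
  line_coef t != 0 -> (t.1.1 + t.1.2 + t.2 <= 2)%N.
Proof.
case: t => -[a b] c /=; case: ((a + b + c)%N =P 0%N) => [->//|_].
by case: ((a + b + c)%N =P 2%N) => [->//|_]; rewrite eqxx.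
Qed.

(** A function [f] picks one term of [line_coefE] in each coordinate; the projections collect the
    exponents of x, y and z in the resulting product. *)
Definition proj1e n (f : {ffun 'I_n -> 'I_3 * 'I_3 * 'I_3}) : exponent n :=
  [ffun i => (f i).1.1].
Definition proj2e n (f : {ffun 'I_n -> 'I_3 * 'I_3 * 'I_3}) : exponent n :=
  [ffun i => (f i).1.2].
Definition proj3e n (f : {ffun 'I_n -> 'I_3 * 'I_3 * 'I_3}) : exponent n :=
  [ffun i => (f i).2].
Definition coefe n (f : {ffun 'I_n -> 'I_3 * 'I_3 * 'I_3}) : F :=
  \prod_(i < n) line_coef (f i).

(** Each factor has degree at most 2, so the three degrees sum to at most [2 * n] and one of them is
    at most a third of that. *)
Lemma coefe_low n (f : {ffun 'I_n -> 'I_3 * 'I_3 * 'I_3}) :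
  coefe f != 0 ->
  [|| proj1e f \in low_exponents n, proj2e f \in low_exponents n
    | proj3e f \in low_exponents n].
Proof.
move=> /prodf_neq0 cf0.
have : (\sum_(i < n) ((f i).1.1 + (f i).1.2 + (f i).2) <= 2 * n)%N.
  rewrite -[n in (_ <= 2 * n)%N]card_ord mulnC -sum_nat_const.
  by apply: leq_sum => i _; apply/line_coef_degree/cf0.
rewrite !big_split /= !inE.
have -> : (\sum_(i < n) proj1e f i = \sum_(i < n) (f i).1.1)%N
  by apply: eq_bigr => i _; rewrite ffunE.
have -> : (\sum_(i < n) proj2e f i = \sum_(i < n) (f i).1.2)%N
  by apply: eq_bigr => i _; rewrite ffunE.
have -> : (\sum_(i < n) proj3e f i = \sum_(i < n) (f i).2)%N
  by apply: eq_bigr => i _; rewrite ffunE.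
move: (\sum_(i < n) (f i).1.1)%N (\sum_(i < n) (f i).1.2)%N => s1 s2.
move: (\sum_(i < n) (f i).2)%N => s3. lia.
Qed.

(** Nonzero elements square to 1, so one nonzero coordinate of the sum kills the product. *)
Lemma zero_indicatorE n (x y z : 'rV[F]_n) :
  \prod_(i < n) (1 - (x 0 i + y 0 i + z 0 i) ^+ 2) = (x + y + z == 0)%:R.
Proof.
case: eqP => [xyz0|/eqP].
  rewrite big1// => i _; have /rowP/(_ i) := xyz0.
  by rewrite !mxE => ->; rewrite expr0n subr0.
have [i xi0 _|all0] := pickP (fun i => (x + y + z) 0 i != 0); last first.
  by case/eqP; apply/rowP => i; have /negbFE/eqP -> := all0 i; rewrite mxE.
rewrite (bigD1 i)//=; have := xi0; rewrite !mxE.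
case: (F3_cases (x 0 i + y 0 i + z 0 i)) => ->; rewrite ?eqxx// => _.
  by rewrite expr1n subrr mul0r.
by rewrite sqrrN expr1n subrr mul0r.
Qed.

Lemma zero_indicator_expand n (x y z : 'rV[F]_n) :
  (x + y + z == 0)%:R =
  \sum_f coefe f * (monomial (proj1e f) x * monomial (proj2e f) y
                    * monomial (proj3e f) z).
Proof.
rewrite -zero_indicatorE.
under eq_bigr do rewrite line_coefE.
rewrite bigA_distr_bigA; apply: eq_bigr => f _.
rewrite !big_split /=; congr (_ * (_ * _ * _));
  by apply: eq_bigr => i _; rewrite ffunE.
Qed.

(* Slice rank: [h] kills every low-degree factor in the third variable, so the
   diagonal matrix [D] obtained by summing the indicator of x + y + z = 0
   against [h] over z in A only involves terms of low degree in x or in y. *)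
Lemma cap_set_bound n (A : {set 'rV[F]_n}) :
  {in A & A & A, forall x y z, x + y + z = 0 -> x = y} ->
  (#|A| <= 3 * #|low_exponents n|)%N.
Proof.
move=> capA; pose L := low_exponents n.
pose ev (i : 'I_#|A|) : 'rV[F]_n := enum_val i.
have evA i : ev i \in A by exact: enum_valP.
pose cole e : 'cV[F]_#|A| := \col_i monomial e (ev i).
have [r [g [h [le_r g_inj hE h1]]]] :=
  annihilator_ones (\matrix_(i < #|A|, j < #|L|) monomial (enum_val j) (ev i)).
pose W e := \sum_k h 0 k * monomial e (ev k).
have W0 e : e \in L -> W e = 0.
  move=> eL; have /rowP/(_ (enum_rank_in eL e)) := hE.
  rewrite !mxE => <-; apply: eq_bigr => k _.
  by rewrite mxE enum_rankK_in.
pose D := \sum_f cole (proj1e f) *m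
                 ((coefe f * W (proj3e f)) *: (cole (proj2e f))^T).
(* On [A] the relation [x + y + z = 0] forces [x = y = z], and conversely [3 x = 0]: only the
   diagonal terms survive. *)
have DE i j : D i j = if i == j then h 0 i else 0.
  transitivity (\sum_k h 0 k * (ev i + ev j + ev k == 0)%:R).
    under [RHS]eq_bigr do rewrite zero_indicator_expand mulr_sumr.
    rewrite exchange_big summxE; apply: eq_bigr => f _ /=.
    rewrite !mxE big_ord1 !mxE mulrCA -mulrA /W mulr_suml mulr_sumr.
    by apply: eq_bigr => k _; ring.
  case: eqP => [<-|ne_ij].
    rewrite (bigD1 i)//= big1 ?addr0 => [|k ne_ki].
      have -> : ev i + ev i + ev i = 0.
        by rewrite -mulr2n -mulrSr -scaler_nat three_eq0 scale0r.
      by rewrite eqxx mulr1.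
    case: eqP => [s0|]; last by rewrite mulr0.
    case/eqP: ne_ki; apply: enum_val_inj.
    by apply: (capA _ (ev i) (ev i)); rewrite ?evA// -addrA addrC.
  rewrite big1// => k _; case: eqP => [s0|]; last by rewrite mulr0.
  by case: ne_ij; apply: enum_val_inj; apply: capA s0; rewrite evA.
have rkD : (\rank D <= #|L| + #|L|)%N.
  rewrite /D (bigID (fun f => proj1e f \in L))/=.
  apply: leq_trans (mxrank_add _ _) _; apply: leq_add.
    exact: mxrank_sum_outer_le.
  (* A term of high degree in both x and y is either of low degree in z, where [W] vanishes, or has
     coefficient 0 by [coefe_low]. *)
  rewrite (bigID (fun f => proj2e f \in L))/= [X in _ + X]big1 ?addr0; last first.
    move=> f /andP[nL1 nL2]; have [L3|nL3] := boolP (proj3e f \in L).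
      by rewrite W0// mulr0 scale0r mulmx0.
    have /eqP-> : coefe f == 0.
      by apply: contraNT nL1 => /coefe_low; rewrite (negPf nL2) (negPf nL3) !orbF.
    by rewrite mul0r scale0r mulmx0.
  rewrite -mxrank_tr raddf_sum /=.
  under eq_bigr do rewrite trmx_mul linearZ /= trmxK -scalemxAl scalemxAr.
  by apply: mxrank_sum_outer_le => f /andP[].
(* The ones of [h] give [D] an identity minor of size [r], so [#|A| - #|L| <= r <= 2 * #|L|]. *)
have : (\rank (1%:M : 'M[F]_r) <= \rank D)%N.
  have -> : 1%:M = rowsub g 1%:M *m D *m colsub g 1%:M.
    rewrite mul_rowsub_mx mul1mx mulmx_colsub mulmx1.
    by apply/matrixP => i j; rewrite !mxE DE (inj_eq g_inj) h1; case: eqP.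
  by rewrite (leq_trans (mxrankM_maxl _ _)) ?mxrankM_maxr.
rewrite mxrank1; rewrite -/L; lia.
Qed.

End CapSet.

(* Markov's inequality for the weight 2 ^ (2 - e i), whose sum over one
   coordinate is 4 + 2 + 1 = 7; cubing avoids the exponent 4n/3. *)
Lemma card_low_exponents n : (#|low_exponents n| ^ 3 * 16 ^ n <= 343 ^ n)%N.
Proof.
have weight (e : {ffun 'I_n -> 'I_3}) :
    (\prod_(i < n) 2 ^ (2 - e i) = 2 ^ (2 * n - \sum_(i < n) e i))%N.
  rewrite -expn_sum; congr (2 ^ _)%N.
  have : (\sum_(i < n) (2 - e i) + \sum_(i < n) e i = 2 * n)%N.
    rewrite -big_split /= -[n in (2 * n)%N]card_ord mulnC -sum_nat_const.
    by apply: eq_bigr => i _; rewrite subnK// -ltnS ltn_ord.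
  by move=> <-; rewrite addnK.
have total : (\sum_(e : {ffun 'I_n -> 'I_3}) \prod_(i < n) 2 ^ (2 - e i) = 7 ^ n)%N.
  rewrite -(bigA_distr_bigA (fun (i : 'I_n) (j : 'I_3) => 2 ^ (2 - j))%N) /=.
  under eq_bigr do rewrite !big_ord_recl big_ord0.
  by rewrite prod_nat_const card_ord.
have le7 : (#|low_exponents n| * 2 ^ (2 * n - (2 * n) %/ 3) <= 7 ^ n)%N.
  rewrite -total (bigID (mem (low_exponents n)))/= -sum_nat_const.
  rewrite (leq_trans _ (leq_addr _ _))// leq_sum// => e.
  by rewrite inE weight leq_exp2l// => ?; apply: leq_sub2l.
rewrite -[343%N]/(7 ^ 3)%N -[16%N]/(2 ^ 4)%N -!expnM [(3 * n)%N]mulnC [(7 ^ _)%N]expnM.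
move: le7; rewrite -(@leq_exp2r _ _ 3)//; apply: leq_trans.
(* The exponents compare by [4 * n <= 3 * (2 * n - (2 * n) %/ 3)]. *)
by rewrite expnMn leq_mul2l -expnM leq_exp2l//; apply/orP; right; lia.
Qed.

(** * Flats, and lines in dense sets *)

Definition has_flat (F : finFieldType) (d n : nat) (S : {set 'rV[F]_n}) : Prop :=
  exists (p : 'rV[F]_n) (U : 'M[F]_(d, n)),
    row_free U /\ forall v, p + v *m U \in S.

(** The constant [b] is chosen before [t]: a dimension linear in the codensity exponent is what
    yields a power saving in the end. *)
Definition dense_flats (F : finFieldType) (d : nat) : Prop :=
  exists b, forall t n (S : {set 'rV[F]_n}),
    (0 < t)%N -> (b * t <= n)%N -> (#|F| ^ n <= #|S| * #|F| ^ t)%N ->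
    has_flat d S.

Lemma has_line (F : finFieldType) n (S : {set 'rV[F]_n}) (p h : 'rV[F]_n) :
  h != 0 -> (forall c : F, p + c *: h \in S) -> has_flat 1 S.
Proof.
move=> h0 hS; exists p, h; split; first by rewrite /row_free rank_rV h0.
by move=> v; rewrite [v]mx11_scalar mul_scalar_mx.
Qed.

(** Over two elements any two distinct points form a line, and [t < 2 * t <= n] forces two points in
    [S]. *)
Lemma dense_lines2 (F : finFieldType) : #|F| = 2%N -> dense_flats F 1.
Proof.
move=> F2; exists 2%N => t n S t0 le_tn; rewrite F2 => dS.
have /card_gt1P[x [y [xS yS nexy]]] : (1 < #|S|)%N.
  rewrite ltnNge; apply/negP => S1; have := leq_trans dS (leq_mul S1 (leqnn _)).
  by rewrite mul1n leq_exp2l//; lia.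
apply: (@has_line _ _ _ x (y - x)); first by rewrite subr_eq0 eq_sym.
move=> c; have : c * (c - 1) == 0.
  by rewrite mulrBr mulr1 -expr2 -[X in _ ^+ X]F2 expf_card subrr.
rewrite mulf_eq0 subr_eq0 => /orP[] /eqP->; first by rewrite scale0r addr0.
by rewrite scale1r addrC subrK.
Qed.

Lemma dense_lines3 (F : finFieldType) : #|F| = 3%N -> dense_flats F 1.
Proof.
move=> F3; exists 40%N => t n S t0 le_tn; rewrite F3 => dS.
apply: contrapT => noline.
(* If [x != y], then [z = - x - y] is the third point of the line through x and y. *)
have capS : {in S & S & S, forall x y z, x + y + z = 0 -> x = y}.
  move=> x y z xS yS zS xyz0; apply/eqP/negPn/negP => nexy; apply: noline.
  apply: (@has_line _ _ _ x (y - x)); first by rewrite subr_eq0 eq_sym.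
  move=> c; case: (F3_cases F3 c) => ->.
  - by rewrite scale0r addr0.
  - by rewrite scale1r addrC subrK.
  - suff -> : x + -1 *: (y - x) = z by [].
    have x2 : x + x = - x.
      apply/esym/addr0_eq.
      by rewrite addrA -mulr2n -mulrSr -scaler_nat (three_eq0 F3) scale0r.
    by rewrite scaleN1r opprB addrA x2 -opprD; apply: addr0_eq.
have leS := cap_set_bound F3 capS.
have := card_low_exponents n.
set M := #|low_exponents n| in leS *; move=> leM.
have le1 : (3 ^ n <= M * 3 ^ t.+1)%N.
  rewrite (leq_trans dS)// expnS mulnA [(M * 3)%N]mulnC leq_mul2r leS orbT//.
(* This is the cube of [le1] times [16 ^ n], with [432 = 27 * 16], combined with [leM]. *)
have le2 : (432 ^ n <= 343 ^ n * 27 ^ t.+1)%N.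
  rewrite -[432%N]/(3 ^ 3 * 16)%N expnMn -[27%N]/(3 ^ 3)%N.
  have -> : ((3 ^ 3) ^ n = (3 ^ n) ^ 3)%N by rewrite -!expnM mulnC.
  have -> : ((3 ^ 3) ^ t.+1 = (3 ^ t.+1) ^ 3)%N by rewrite -!expnM mulnC.
  apply: leq_trans (leq_mul leM (leqnn _)).
  rewrite mulnAC leq_mul2r -expnMn leq_exp2r// le1 orbT//.
(* 5 / 4 < 432 / 343 and (5 / 4) ^ 20 > 27. *)
have le3 : (5 ^ n <= 4 ^ n * 27 ^ t.+1)%N.
  rewrite -(@leq_pmul2l (343 ^ n)) ?expn_gt0// -expnMn.
  apply: leq_trans (_ : (432 * 4) ^ n <= _)%N; first by rewrite leq_exp2r//; lia.
  by rewrite expnMn mulnA [(343 ^ n * _)%N]mulnC -mulnA [X in (X <= _)%N]mulnC leq_mul2l le2 orbT.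
(* Here [40 * t >= 20 * t.+1] because [0 < t]. *)
have [s ns] : exists s, n = (20 * t.+1 + s)%N by exists (n - 20 * t.+1)%N; lia.
(* It follows from [4 ^ 4 * 2 <= 5 ^ 4] and [27 < 2 ^ 5]. *)
have lt4 : (4 ^ (20 * t.+1) * 27 ^ t.+1 < 5 ^ (20 * t.+1))%N.
  have -> : (20 * t.+1 = 4 * (5 * t.+1))%N by rewrite mulnA.
  apply: leq_trans (_ : (4 ^ 4 * 2) ^ (5 * t.+1) <= _)%N; last first.
    by rewrite [(5 ^ _)%N]expnM leq_exp2r//.
  rewrite expnMn -expnM ltn_mul2l expn_gt0/= [(2 ^ _)%N]expnM.
  by rewrite ltn_exp2r.
move: le3; rewrite ns !expnD leqNgt => /negP; apply.
rewrite mulnAC; apply: leq_trans (_ : 5 ^ (20 * t.+1) * 4 ^ s <= _)%N.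
  by rewrite ltn_mul2r expn_gt0.
rewrite leq_mul2l; case: s {ns} => [|s]; first by rewrite orbT.
by rewrite leq_exp2r ?orbT.
Qed.

(** * Raising the dimension of flats by one *)

Lemma pigeonhole_cover (I J : finType) (P : I -> pred J) (G : {set J}) :
  (0 < #|I|)%N -> (forall y, y \in G -> exists i, P i y) ->
  exists i, (#|G| <= #|[set y | P i y]| * #|I|)%N.
Proof.
move=> /card_gt0P[i0 _] GP.
have leG : (#|G| <= \sum_i #|[set y | P i y]|)%N.
  under eq_bigr do rewrite -sum1dep_card big_mkcond.
  rewrite exchange_big /= -sum1_card [X in (X <= _)%N]big_mkcond.
  apply: leq_sum => y _; case: ifP => // /GP[i Piy].
  by rewrite (bigD1 i)//= Piy.
case: (@arg_maxnP _ i0 xpredT (fun i => #|[set y | P i y]|) isT) => i _ maxi.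
exists i; apply: leq_trans leG _.
by rewrite mulnC -sum_nat_const; apply: leq_sum => j _; apply: maxi.
Qed.

Definition fibre (F : finFieldType) r s (S : {set 'rV[F]_(r + s)})
    (y : 'rV[F]_s) : {set 'rV[F]_r} := [set u | row_mx u y \in S].

Lemma card_fibres (F : finFieldType) r s (S : {set 'rV[F]_(r + s)}) :
  (#|S| <= \sum_y #|fibre S y|)%N.
Proof.
rewrite -sum1_card (partition_big (fun z => rsubmx z) xpredT)//=.
apply: leq_sum => y _; rewrite sum1dep_card.
apply: leq_trans (leq_imset_card (fun u => row_mx u y) (fibre S y)).
apply/subset_leq_card/fintype.subsetP => z; rewrite inE => /andP[zS /eqP<-].
by apply/imsetP; exists (lsubmx z); rewrite ?inE hsubmxK.
Qed.

(** A line in the first factor times a flat in [T] is a flat; its directions form a block diagonal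
    matrix. *)
Lemma has_flat_product (F : finFieldType) d r s (S : {set 'rV[F]_(r + s)})
    (a : 'rV[F]_r) (h : 'rV[F]_r) (T : {set 'rV[F]_s}) :
  row_free h -> (forall y, y \in T -> forall v, row_mx (a + v *m h) y \in S) ->
  has_flat d T -> has_flat d.+1 S.
Proof.
move=> h_free hS [p [U [U_free hT]]].
have block_free : row_free (block_mx h 0 0 U).
  rewrite /row_free rank_diag_block_mx; move: h_free U_free.
  by rewrite /row_free => /eqP-> /eqP->.
have inS (w : 'rV[F]_(1 + d)) : row_mx a p + w *m block_mx h 0 0 U \in S.
  rewrite -[w]hsubmxK mul_row_block !mulmx0 addr0 add0r add_row_mx.
  exact: hS.
by exists (row_mx a p), (block_mx h 0 0 U).
Qed.

(* Write F^n as F^r x F^s with r linear in t.  A fibre of density at least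
   [q ^ - t.+1] contains a line, and by pigeonhole some line lies in a
   proportion [q ^ - O(t)] of the fibres; a flat in the set of those fibres
   times that line is a flat of one more dimension. *)
Lemma dense_flatsS (F : finFieldType) d :
  dense_flats F 1 -> dense_flats F d -> dense_flats F d.+1.
Proof.
move=> [c lineF] [b flatF].
(* As [2 * t >= t.+1], this leaves room for [r + b * t'] coordinates. *)
exists (2 * (c + b * (2 * c + 1)))%N => t n S t0 le_tn dS.
pose q := #|F|; have q1 : (1 < q)%N by apply: finNzRing_gt1.
(* The exponent [t'] is [2 * r + t.+1]: there are [q ^ (2 * r)] pairs (base point, direction), and
   [G] has density at least [q ^ - t.+1]. *)
pose r := (c * t.+1)%N; pose t' := ((2 * c + 1) * t.+1)%N.
have [s ns] : exists s, n = (r + s)%N by exists (n - r)%N; rewrite /r; nia.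
have le_t's : (b * t' <= s)%N by rewrite /t'; nia.
move: S dS; rewrite ns => {n le_tn ns} S dS.
pose G := [set y | (q ^ r <= #|fibre S y| * q ^ t.+1)%N].
(* Fibres outside [G] cover at most a share [q ^ - t.+1] of the space, which is at most half of the
   share [q ^ - t] guaranteed for [S]; hence the threshold [t.+1]. *)
have cardG : (q ^ s <= #|G| * q ^ t.+1)%N.
  have le1 : (#|S| * q ^ t.+1 <= #|G| * q ^ t.+1 * q ^ r + q ^ s * q ^ r)%N.
    apply: leq_trans (leq_mul (card_fibres S) (leqnn _)) _.
    rewrite big_distrl /= (bigID (mem G))/= leq_add//.
      rewrite -mulnA -sum_nat_const leq_sum// => y _.
      rewrite mulnC leq_mul2l; apply/orP; right.
      by rewrite (leq_trans (max_card _))// card_mx mul1n.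
    apply: leq_trans (_ : \sum_(y : 'rV[F]_s) q ^ r <= _)%N; last first.
      by rewrite sum_nat_const card_mx mul1n.
    rewrite [X in (X <= _)%N]big_mkcond leq_sum// => y _.
    by case: ifP => //; rewrite inE -ltnNge => /ltnW.
  have le2 : (q * (q ^ s * q ^ r) <= #|S| * q ^ t.+1)%N.
    by rewrite expnS [(#|S| * _)%N]mulnCA leq_mul2l -expnD [(s + r)%N]addnC dS orbT.
  have := leq_trans (leq_mul q1 (leqnn _)) (leq_trans le2 le1).
  rewrite mul2n -addnn leq_add2r leq_pmul2r ?expn_gt0 ?(ltnW q1)//.
pose P (ah : 'rV[F]_r * 'rV[F]_r) y :=
  row_free ah.2 && [forall v : 'rV[F]_1, row_mx (ah.1 + v *m ah.2) y \in S].
have [|y|[a h] cardT] := @pigeonhole_cover _ _ P G.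
- by apply/card_gt0P; exists (0, 0).
- rewrite inE => /(lineF t.+1 r) [//|//|a [h [h_free hS]]].
  exists (a, h); rewrite /P h_free; apply/fintype.forallP => v.
  by have := hS v; rewrite inE.
(* Since [G] is nonempty, so is the class of the chosen pair, and its direction [h] is therefore
   nonzero. *)
have G_gt0 : (0 < #|G|)%N.
  rewrite lt0n; apply: contraTneq cardG => ->.
  by rewrite -ltnNge expn_gt0 (ltnW q1).
have h_free : row_free h.
  have /card_gt0P[y] : (0 < #|[set y | P (a, h) y]|)%N.
    by rewrite lt0n; apply: contraTneq cardT => ->; rewrite -ltnNge.
  by rewrite inE => /andP[].
apply: (@has_flat_product _ d r s S a h [set y | P (a, h) y]) => //.
  by move=> y; rewrite inE => /andP[_ /fintype.forallP].
apply: (flatF t' s) => //; first by rewrite /t'; lia.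
apply: leq_trans cardG _; rewrite -/q.
apply: leq_trans (leq_mul cardT (leqnn _)) _.
rewrite -mulnA leq_mul2l card_prod !card_mx !mul1n -!expnD.
by rewrite leq_exp2l// /t' /r; apply/orP; right; lia.
Qed.

Lemma dense_flats_all (F : finFieldType) d :
  #|F| = 2%N \/ #|F| = 3%N -> dense_flats F d.
Proof.
move=> hq; have lineF : dense_flats F 1.
  by case: hq => [/dense_lines2|/dense_lines3].
elim: d => [|d IHd]; last exact: dense_flatsS.
exists 0%N => t n S _ _ dS.
have /card_gt0P[p pS] : (0 < #|S|)%N.
  rewrite lt0n; apply: contraTneq dS => ->.
  by rewrite mul0n -ltnNge expn_gt0 (ltnW (finNzRing_gt1 F)).
exists p, 0; split; first by rewrite /row_free mxrank0.
by move=> v; rewrite mulmx0 addr0.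
Qed.

(** * From flats to generic solutions and the power saving *)

(** Weights of sum 0, among them the rows of [A], cancel the base point [p]. As [U] is injective,
    the relation then says [mu *m cokermx A = 0], that is, [mu] lies in the row space of [A]. *)
Lemma flat_generic_solution (F : finFieldType) m k n (A : 'M[F]_(m, k))
    (S : {set 'rV[F]_n}) :
  row_balanced A -> has_flat k S ->
  exists x : 'I_k -> 'rV[F]_n, generic_solution A x /\ contained x S.
Proof.
move=> hbal [p [U [U_free hS]]].
pose x j := p + row j (cokermx A) *m U.
have sumx (mu : 'rV[F]_k) : \sum_j mu 0 j = 0 ->
    \sum_j mu 0 j *: x j = mu *m cokermx A *m U.
  move=> mu0; under eq_bigr do rewrite scalerDr.
  rewrite big_split /= -scaler_suml mu0 scale0r add0r.
  rewrite [mu *m cokermx A]mulmx_sum_row mulmx_suml.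
  by apply: eq_bigr => j _; rewrite scalemxAl.
exists x; split; last by move=> j; apply: hS.
split=> [i|mu mu0].
  have rowA0 : \sum_j row i A 0 j = 0.
    by rewrite -[RHS](hbal i); apply: eq_bigr => j _; rewrite mxE.
  have := sumx _ rowA0; rewrite -row_mul mulmx_coker row0 mul0mx => sum0; rewrite -[RHS]sum0.
  by apply: eq_bigr => j _; rewrite mxE.
rewrite sumx// => /eqP; rewrite mulmx_free_eq0// => coker0.
by rewrite submxE.
Qed.

Theorem theoremB (R : realType) (F : finFieldType)
    (hq : #|F| = 2%N \/ #|F| = 3%N)
    (m k : nat) (A : 'M[F]_(m, k))
    (hbal : row_balanced A) (hrank : \rank A = m) :
  temperate R A.
Proof.
have [b flatF] := dense_flats_all k hq.
have q1 := finNzRing_gt1 F.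
have q0 : 0 < #|F|%:R :> R by rewrite ltr0n; lia.
(* Using [b.+1] keeps the denominator positive. With [t] the floor of [n / b.+1], the bound
   [q ^ (n - t)] has exponent below [(1 - delta) * n + 1], so the constant [q] absorbs the rounding;
   [b.+1 <= n] makes [t] positive. *)
exists (b.+1%:R^-1); first by rewrite invr_gt0.
exists #|F|%:R; exists b.+1 => // n /= le_bn S noS.
pose t := (n %/ b.+1)%N.
have lt_S : (#|S| * #|F| ^ t < #|F| ^ n)%N.
  rewrite ltnNge; apply/negP => dS; apply: noS.
  apply: flat_generic_solution => //; apply: (flatF t) dS.
    by rewrite divn_gt0.
  by rewrite (leq_trans _ (leq_trunc_div n b.+1))// mulnC leq_mul2l leqnSn orbT.
have le_tn : (t <= n)%N by exact: leq_div.
have leS : (#|S| <= #|F| ^ (n - t))%N.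
  rewrite -(@leq_pmul2r (#|F| ^ t)) ?expn_gt0 ?(ltnW q1)//.
  by rewrite -expnD subnK// ltnW.
apply: (@le_trans _ _ (#|F| ^ (n - t))%:R); first by rewrite ler_nat.
rewrite natrX -powR_mulrn ?(ltW q0)// -{2}[#|F|%:R]powRr1 ?(ltW q0)//.
rewrite -powRD ?(gt_eqF q0) ?implybT//.
apply: ler_powR; first by rewrite ler1n ltnW.
have : n%:R <= (t.+1 * b.+1)%:R :> R.
  by rewrite ler_nat ltnW// ltn_ceil.
rewrite natrM -ler_pdivrMr ?ltr0n// natrB// -natr1 => le_nt.
by rewrite mulrBl mul1r [_^-1 * _]mulrC; lra.
Qed.
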